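(* Let $n\ge 1$ be an integer and let $V(n)$ be the $\mathbb{Q}$-vector space with basis $\phi_0,\ldots,\phi_{n-1}$. Let $E_i,F_i,H_i$ ($0\le i\le n$) be the linear operators on $\bigwedge^*(V(n))$ defined in the context, and let $(a_{ij})_{0\le i,j\le n}$ be the Cartan matrix of type $D_{n+1}$, with nodes labelled as in the context. Then for all $0\le i,j\le n$: (1) $[H_i,H_j]=0$; (2) $[E_i,F_j]=\delta_{ij}H_i$; (3) $[H_i,E_j]=a_{ji}E_j$ and $[H_i,F_j]=-a_{ji}F_j$; (4) $(\mathrm{ad}\,E_i)^{-a_{ji}+1}(E_j)=0$ if $i\ne j$; (5) $(\mathrm{ad}\,F_i)^{-a_{ji}+1}(F_j)=0$ if $i\neq j$.
   Context: $[A,B]=AB-BA$ is the commutator of linear operators and $(\mathrm{ad}\,A)(B)=[A,B]$. The space $\bigwedge^*(V(n))$ has basis the monomials $\phi_{k_1}\wedge\cdots\wedge\phi_{k_d}$ with $0\le k_1<\cdots<k_d\le n-1$, $0\le d\le n$. For $0\le i\le n-1$, $\alpha_i^+$ is left wedge multiplication, $\alpha_i^+(P)=\phi_i\wedge P$, and $\alpha_i^-=\partial_i^R$ is the right partial derivative: for $k_1<\cdots<k_d$, if $i=k_s$ then $\partial_i^R(\phi_{k_1}\wedge\cdots\wedge\phi_{k_d})=(-1)^{d-s}\phi_{k_1}\wedge\cdots\wedge\widehat{\phi_{k_s}}\wedge\cdots\wedge\phi_{k_d}$, and if $i\notin\{k_1,\ldots,k_d\}$ then $\partial_i^R(\phi_{k_1}\wedge\cdots\wedge\phi_{k_d})=0$.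 Put $H=[\alpha_0^+,\alpha_0^-]$ and, for $0\le i\le n-1$, $$T_i=\frac{\alpha_i^++[H,\alpha_i^+]/2}{2},\qquad S_i=\frac{\alpha_i^--[H,\alpha_i^-]/2}{2}.$$ Define $$E_0=-\frac{\alpha_0^-+[H,\alpha_0^-]/2}{2},\quad F_0=\frac{\alpha_0^+-[H,\alpha_0^+]/2}{2},\quad E_1=S_0,\quad F_1=T_0,$$ $$E_i=[T_{i-2},S_{i-1}],\quad F_i=[T_{i-1},S_{i-2}]\quad(2\le i\le n),\qquad H_i=[E_i,F_i]\quad(0\le i\le n).$$ Labelling of the Cartan matrix of type $D_{n+1}$: $a_{ii}=2$ for $0\le i\le n$; $a_{02}=a_{20}=a_{12}=a_{21}=-1$; $a_{i-1,i}=a_{i,i-1}=-1$ for $3\le i\le n$; all other entries are $0$ (in particular $a_{01}=a_{10}=0$). Entries with an index exceeding $n$ are absent. *)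

(* Defs.v *)
From HB Require Import structures.
From mathcomp Require Import all_boot all_order all_algebra.
Set Implicit Arguments. Unset Strict Implicit. Unset Printing Implicit Defensive.
Import Order.TTheory GRing.Theory Num.Theory.
Local Open Scope ring_scope.

(* The exterior algebra of the rational vector space with basis
   phi_0, ..., phi_(n-1), in coordinates on its monomial basis: P K is the
   coefficient of phi_k1 /\ ... /\ phi_kd, where k1 < ... < kd enumerates K.
   Beware that the pointwise product carried by {ffun _ -> _} is not the
   exterior product; the latter is [wedge] below. *)
Notation ext n := {ffun {set 'I_n} -> rat^o}.

Definition mono n (K : {set 'I_n}) : ext n := [ffun L => (L == K)%:R].

(* Indices of generators range over nat so that index shifts need no casts;
   phi n i, and the operators built from it, are 0 when n <= i. *)
Definition phi n (i : nat) : ext n :=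
  if insub i is Some k then mono [set k : 'I_n] else 0.

(* The sign is that of the permutation sorting the concatenation of the
   increasing enumerations of K and L. *)
Definition wedge_mono n (K L : {set 'I_n}) : ext n :=
  if [disjoint K & L] then
    (-1) ^+ #|[set p in setX K L | (p.2 < p.1)%N]| *: mono (K :|: L)
  else 0.

Definition wedge n (P Q : ext n) : ext n :=
  \sum_(K : {set 'I_n}) \sum_(L : {set 'I_n}) (P K * Q L) *: wedge_mono K L.

(* If K = {k_1 < ... < k_d} and i = k_s, then d - s is the number of elements
   of K above i. *)
Definition rderiv_mono n (i : nat) (K : {set 'I_n}) : ext n :=
  if insub i is Some k then
    if k \in K then (-1) ^+ #|[set l in K | (k < l)%N]| *: mono (K :\ k) else 0
  else 0.

Definition rderiv n (i : nat) (P : ext n) : ext n :=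
  \sum_(K : {set 'I_n}) P K *: rderiv_mono i K.

Lemma wedge_is_linear n (P : ext n) : linear (wedge P).
Proof.
move=> a Q R; rewrite /wedge scaler_sumr -big_split; apply: eq_bigr => K _.
rewrite scaler_sumr -big_split; apply: eq_bigr => L _ /=.
by rewrite !ffunE scalerA -scalerDl mulrDr (mulrCA a).
Qed.
HB.instance Definition _ n (P : ext n) :=
  GRing.isLinear.Build rat (ext n) (ext n) _ (wedge P) (wedge_is_linear P).

Lemma rderiv_is_linear n i : linear (@rderiv n i).
Proof.
move=> a Q R; rewrite /rderiv scaler_sumr -big_split; apply: eq_bigr => K _ /=.
by rewrite !ffunE scalerA -scalerDl.
Qed.
HB.instance Definition _ n i :=
  GRing.isLinear.Build rat (ext n) (ext n) _ (@rderiv n i) (@rderiv_is_linear n i).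

Lemma ext_mono n (P : ext n) : P = \sum_(K : {set 'I_n}) P K *: mono K.
Proof.
apply/ffunP => L; rewrite sum_ffunE (bigD1 L) //= !ffunE eqxx big1 => [|K neKL].
  by rewrite addr0 [RHS]mulr1.
by rewrite !ffunE eq_sym (negbTE neKL) [LHS]mulr0.
Qed.

Lemma wedge_monoE n (K L : {set 'I_n}) : wedge (mono K) (mono L) = wedge_mono K L.
Proof.
rewrite /wedge (bigD1 K) //= (bigD1 L) //= !ffunE !eqxx mulr1 scale1r.
rewrite big1 => [|M /negbTE neM]; last by rewrite !ffunE neM mulr0 scale0r.
rewrite big1 => [|M /negbTE neM]; first by rewrite !addr0.
by apply: big1 => N _; rewrite !ffunE neM mul0r scale0r.
Qed.

Lemma rderiv_monoE n i (K : {set 'I_n}) : rderiv i (mono K) = rderiv_mono i K.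
Proof.
rewrite /rderiv (bigD1 K) //= !ffunE eqxx scale1r.
by rewrite big1 ?addr0 // => M /negbTE neM; rewrite !ffunE neM scale0r.
Qed.

Lemma wedge_phiC n (i j : nat) :
  wedge (phi n i) (phi n j) = - wedge (phi n j) (phi n i).
Proof.
have w0l (P : ext n) : wedge 0 P = 0.
  by apply: big1 => K _; apply: big1 => L _; rewrite ffunE mul0r scale0r.
rewrite /phi; case: insubP => [k _ _|_]; last by rewrite w0l linear0 oppr0.
case: insubP => [l _ _|_]; last by rewrite w0l linear0 oppr0.
rewrite !wedge_monoE /wedge_mono disjoint_sym setUC.
case: ifP => [|_]; last by rewrite oppr0.
rewrite disjoints1 inE => nekl; rewrite -scaleNr; congr (_ *: _).
have cardE (a b : 'I_n) :
    #|[set p in setX [set a] [set b] | (p.2 < p.1)%N]| = (b < a)%N :> nat.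
  rewrite (_ : [set p in _ | _] = if (b < a)%N then [set (a, b)] else set0);
    first by case: ifP => _; rewrite ?cards1 ?cards0.
  apply/setP => -[x y]; rewrite !inE /=; case: ifP => ba; rewrite !inE ?xpair_eqE.
    by case: eqVneq => //= ->; case: eqVneq => //= ->.
  by case: eqVneq => //= ->; case: eqVneq => //= ->.
rewrite !cardE; case: (ltngtP k l) => [_|_|/val_inj eq_kl].
- by rewrite expr0 expr1 opprK.
- by rewrite expr0 expr1.
- by rewrite eq_kl eqxx in nekl.
Qed.

Lemma wedgeA n : associative (@wedge n).
Proof.
have wDl (P Q R : ext n) : wedge (P + Q) R = wedge P R + wedge Q R.
  rewrite /wedge -big_split; apply: eq_bigr => K _; rewrite -big_split.
  by apply: eq_bigr => L _; rewrite ffunE mulrDl scalerDl.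
have wZl a (P R : ext n) : wedge (a *: P) R = a *: wedge P R.
  rewrite /wedge scaler_sumr; apply: eq_bigr => K _; rewrite scaler_sumr.
  by apply: eq_bigr => L _; rewrite ffunE scalerA mulrA.
have w0l (P : ext n) : wedge 0 P = 0.
  by rewrite -[X in wedge X _](scale0r 0) wZl scale0r.
have mono_ext (f g : ext n -> ext n) : linear f -> linear g ->
    (forall K, f (mono K) = g (mono K)) -> f =1 g.
  move=> linf ling fg P.
  pose F := GRing.isLinear.Build rat (ext n) (ext n) _ f linf.
  pose G := GRing.isLinear.Build rat (ext n) (ext n) _ g ling.
  pose f' : {linear ext n -> ext n} := HB.pack f F.
  pose g' : {linear ext n -> ext n} := HB.pack g G.
  rewrite -[f]/(f' : _ -> _) -[g]/(g' : _ -> _) [P]ext_mono !linear_sum.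
  by apply: eq_bigr => K _; rewrite !linearZ /= fg.
suff wM K L M : wedge (mono K) (wedge (mono L) (mono M)) =
                wedge (wedge (mono K) (mono L)) (mono M) :> ext n.
  move=> P Q R.
  apply: (mono_ext (fun P => wedge P (wedge Q R)) (fun P => wedge (wedge P Q) R)).
  - by move=> a x y; rewrite wDl wZl.
  - by move=> a x y; rewrite !wDl !wZl.
  move=> K; apply: (mono_ext (fun Q => wedge _ (wedge Q R))
                             (fun Q => wedge (wedge _ Q) R)).
  - by move=> a x y; rewrite wDl wZl linearP.
  - by move=> a x y; rewrite linearP wDl wZl.
  move=> L; apply: (mono_ext (fun R => wedge _ (wedge _ R)) (wedge _)).
  - by move=> a x y; rewrite !linearP.
  - exact: linearP.
  exact: wM.
pose s (A B : {set 'I_n}) := [set p in setX A B | (p.2 < p.1)%N].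
have sUl (A B C : {set 'I_n}) :
    [disjoint A & B] -> #|s (A :|: B) C| = (#|s A C| + #|s B C|)%N.
  move=> AB; rewrite (_ : s _ _ = s A C :|: s B C); last first.
    by apply/setP => p; rewrite !inE -!andb_orl.
  apply/eqP; rewrite cardsU -[X in _ == X]subn0 eq_sym; apply/eqP; congr (_ - _)%N.
  apply/esym/eqP; rewrite cards_eq0 -subset0; apply/subsetP => p; rewrite !inE.
  by case/andP => /andP[/andP[/(disjointFr AB)->]].
have sUr (A B C : {set 'I_n}) :
    [disjoint B & C] -> #|s A (B :|: C)| = (#|s A B| + #|s A C|)%N.
  move=> BC; rewrite (_ : s _ _ = s A B :|: s A C); last first.
    by apply/setP => p; rewrite !inE andb_orr andb_orl.
  apply/eqP; rewrite cardsU -[X in _ == X]subn0 eq_sym; apply/eqP; congr (_ - _)%N.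
  apply/esym/eqP; rewrite cards_eq0 -subset0; apply/subsetP => p; rewrite !inE.
  case/andP => /andP[/andP[_ pB] _] /andP[/andP[_ pC] _].
  by rewrite (disjointFr BC pB) in pC.
rewrite !wedge_monoE /wedge_mono -!/(s _ _).
case: (boolP [disjoint L & M]) => LM; case: (boolP [disjoint K & L]) => KL.
- rewrite linearZ wZl /= !wedge_monoE /wedge_mono -!/(s _ _).
  rewrite -![[disjoint _ & _]]setI_eq0 setIUr setIUl !setU_eq0.
  rewrite !setI_eq0 KL LM /= andbT; case: ifP => _; last by rewrite !scaler0.
  rewrite !scalerA -!exprD setUA sUl // sUr //.
  by congr (_ ^+ _ *: _); rewrite addnC addnA.
- rewrite w0l linearZ /= wedge_monoE /wedge_mono.
  by rewrite -[[disjoint K & _]]setI_eq0 setIUr setU_eq0 !setI_eq0 (negbTE KL) scaler0.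
- rewrite linear0 wZl wedge_monoE /wedge_mono.
  rewrite -[[disjoint _ :|: _ & _]]setI_eq0 setIUl setU_eq0 !setI_eq0 (negbTE LM).
  by rewrite andbF scaler0.
- by rewrite w0l linear0.
Qed.

Lemma mono_cons n (k : 'I_n) (K : {set 'I_n}) :
  {in K, forall l : 'I_n, (k < l)%N} -> wedge (phi n k) (mono K) = mono (k |: K).
Proof.
move=> kK; rewrite /phi valK wedge_monoE /wedge_mono disjoints1.
case: ifPn => [_|/negPn/kK]; last by rewrite ltnn.
rewrite (_ : [set p in _ | _] = set0) ?cards0 ?expr0 ?scale1r //.
apply/setP => -[x y]; rewrite !inE /=; apply/negP => /andP[/andP[/eqP-> /kK]].
by rewrite ltnNge => /negP kl /ltnW.
Qed.

Definition alphap n (i : nat) : 'End(ext n) := linfun (wedge (phi n i)).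
Definition alpham n (i : nat) : 'End(ext n) := linfun (@rderiv n i).

Definition lcomm (vT : vectType rat) (A B : 'End(vT)) : 'End(vT) :=
  (A \o B)%VF - (B \o A)%VF.

Definition ad (vT : vectType rat) (A : 'End(vT)) : 'End(vT) -> 'End(vT) := lcomm A.

Definition opH n : 'End(ext n) := lcomm (alphap n 0) (alpham n 0).

Definition opT n (i : nat) : 'End(ext n) :=
  2^-1 *: (alphap n i + 2^-1 *: lcomm (opH n) (alphap n i)).

Definition opS n (i : nat) : 'End(ext n) :=
  2^-1 *: (alpham n i - 2^-1 *: lcomm (opH n) (alpham n i)).

Definition genE n (i : nat) : 'End(ext n) :=
  match i with
  | 0 => - (2^-1 *: (alpham n 0 + 2^-1 *: lcomm (opH n) (alpham n 0)))
  | 1 => opS n 0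
  | k.+2 => lcomm (opT n k) (opS n k.+1)
  end.

Definition genF n (i : nat) : 'End(ext n) :=
  match i with
  | 0 => 2^-1 *: (alphap n 0 - 2^-1 *: lcomm (opH n) (alphap n 0))
  | 1 => opT n 0
  | k.+2 => lcomm (opT n k.+1) (opS n k)
  end.

Definition genH n (i : nat) : 'End(ext n) := lcomm (genE n i) (genF n i).

(* Dynkin diagram of type D_(n+1): nodes 0 and 1 are both joined to node 2,
   and 2 - 3 - ... - n is a chain. *)
Definition cartanD n : 'M[int]_n.+1 :=
  \matrix_(i < n.+1, j < n.+1)
    if i == j then 2
    else if (nat_of_ord i, nat_of_ord j) \in [:: (0, 2); (2, 0); (1, 2); (2, 1)]%N
    then -1
    else if [&& 3 <= j & j == i.+1 :> nat]%N || [&& 3 <= i & i == j.+1 :> nat]%N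
    then -1
    else 0.

(* Main.v *)
Require Import Defs.
From HB Require Import structures.
From mathcomp Require Import all_boot all_order all_algebra.
Import Order.TTheory GRing.Theory Num.Theory.
Local Open Scope ring_scope.

(** Write P for the parity operator ((-1)^d in degree d) on the exterior
    algebra, p_i for the creation operator alpha_i^+ and a_i = P alpha_i^- for
    the annihilation operator, which is the left derivative. The p_i and a_i
    satisfy the canonical anticommutation relations

      p_i p_j + p_j p_i = a_i a_j + a_j a_i = 0,   p_i a_j + a_j p_i = delta_ij,

    and anticommute with P ([ladder_acomm], [parity_ladder]). The operator H
    is - P, so the corrections by [H, _] / 2 are just restrictions to the even
    or to the odd part. With Q_0, Q_1 the projections onto these two parts and
    X_ij = p_i a_j, this gives ([genEE], [genFE])

      E_0 = a_0 Q_0,  E_1 = a_0 Q_1,  E_(k+2) = X_(k,k+1),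
      F_0 = p_0 Q_1,  F_1 = p_0 Q_0,  F_(k+2) = X_(k+1,k),

    and therefore H_s = Q_(1-s) - X_00 for s = 0, 1, while
    H_(k+2) = X_kk - X_(k+1,k+1).

    All the relations then follow from a small multiplication table. The X_ij
    bracket like matrix units ([lcomm_hop]); they commute with P, and p_k, a_k
    span the vector representation and its dual ([lcomm_hop_p], [lcomm_hop_a]).
    For x, y odd with x y + y x = c, one has [x Q_s, y Q_s] = 0 and
    [x Q_s, y Q_(1-s)] = x y - c Q_s ([lcomm_half_same], [lcomm_half]), because
    an odd operator exchanges Q_0 and Q_1. Each relation is read off according
    to whether each of the two nodes lies at the fork {0, 1} of the Dynkin
    diagram or on the chain; this part uses only the anticommutation relations
    and is done on an arbitrary rational vector space ([fermion_relations]). *)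

Set Implicit Arguments.
Unset Strict Implicit.
Unset Printing Implicit Defensive.

(** * Commutators and anticommutators *)

Section Commutators.
Context (vT : vectType rat).
Implicit Types (A B C x y Q : 'End(vT)).

(** The anticommutator. *)
Definition acomm A B : 'End(vT) := (A \o B)%VF + (B \o A)%VF.

Lemma lcommC A B : lcomm A B = - lcomm B A.
Proof. by rewrite /lcomm opprB. Qed.

Lemma lcommDr A B C : lcomm A (B + C) = lcomm A B + lcomm A C.
Proof. by rewrite /lcomm comp_lfunDr comp_lfunDl opprD addrACA. Qed.

Lemma lcommNr A B : lcomm A (- B) = - lcomm A B.
Proof. by rewrite /lcomm comp_lfunNr comp_lfunNl opprD. Qed.

Lemma lcommZr c A B : lcomm A (c *: B) = c *: lcomm A B.
Proof. by rewrite /lcomm -comp_lfunZr -comp_lfunZl scalerBr. Qed.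

Lemma lcommBl A B C : lcomm (A - B) C = lcomm A C - lcomm B C.
Proof.
by rewrite lcommC lcommDr lcommNr opprD -lcommC; congr (_ + _); rewrite -lcommC.
Qed.

Lemma lcommNl A B : lcomm (- A) B = - lcomm A B.
Proof. by rewrite lcommC lcommNr -lcommC. Qed.

(** The adjoint action is a derivation. *)
Lemma lcomm_compr A B C :
  lcomm A (B \o C)%VF = ((lcomm A B \o C) + (B \o lcomm A C))%VF.
Proof.
by rewrite /lcomm comp_lfunDl comp_lfunDr comp_lfunNl comp_lfunNr !comp_lfunA
           addrA subrK.
Qed.

(** Useful for odd operators, whose anticommutators are simpler than their
    commutators. *)
Lemma lcomm_compl_acomm A B C :
  lcomm (A \o B)%VF C = ((A \o acomm B C) - (acomm A C \o B))%VF.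
Proof.
by rewrite /lcomm /acomm comp_lfunDl comp_lfunDr !comp_lfunA opprD addrA addrK.
Qed.

Lemma acommC A B : acomm A B = acomm B A.
Proof. exact: addrC. Qed.

Lemma acomm0_compE A B : acomm A B = 0 -> (A \o B = - (B \o A))%VF.
Proof. by move/eqP; rewrite addr_eq0 => /eqP. Qed.

Lemma acomm0_compxx A : acomm A A = 0 -> (A \o A)%VF = 0.
Proof. by move/eqP; rewrite /acomm -mulr2n -scaler_nat scaler_eq0 => /eqP. Qed.

(** The case of interest is that of the complementary projections [Q] and [Q']
    onto the even and odd parts, exchanged by odd [x] and [y]. *)
Lemma lcomm_cutoff (c : rat) x y Q Q' :
  (Q \o y = y \o Q')%VF -> (Q' \o x = x \o Q)%VF ->
  (Q \o Q)%VF = Q -> (Q' \o Q')%VF = Q' -> Q' + Q = \1%VF ->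
  acomm x y = c *: \1%VF ->
  lcomm (x \o Q)%VF (y \o Q')%VF = (x \o y)%VF - c *: Q.
Proof.
move=> Qy Qx QQ QQ' Q1 xy; rewrite /lcomm.
have -> : ((x \o Q) \o (y \o Q') = (x \o y) \o Q')%VF.
  by rewrite -comp_lfunA (comp_lfunA Q) Qy -(comp_lfunA y) QQ' comp_lfunA.
have -> : ((y \o Q') \o (x \o Q) = (y \o x) \o Q)%VF.
  by rewrite -comp_lfunA (comp_lfunA Q') Qx -(comp_lfunA x) QQ comp_lfunA.
have -> : (y \o x)%VF = c *: \1%VF - (x \o y)%VF.
  by rewrite -xy /acomm addrAC subrr add0r.
rewrite comp_lfunDl comp_lfunNl -comp_lfunZl comp_lfun1l opprB addrA.
by rewrite -comp_lfunDr Q1 comp_lfun1r.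
Qed.

End Commutators.

(** * The Dynkin diagram by cases *)

(** A node at most [n] is either one of the two ends 0, 1 of the fork, encoded
    by a boolean, or a node [k.+2] of the chain. *)
Variant node_spec n : nat -> Type :=
  | ForkNode (s : bool) : node_spec n s
  | ChainNode k of (k.+1 < n)%N : node_spec n k.+2.

Lemma nodeP n (i : 'I_n.+1) : node_spec n i.
Proof.
case: i => [[|[|k]] ltin] /=; first exact: (ForkNode n false).
  exact: (ForkNode n true).
exact: ChainNode.
Qed.

(** The entries of [cartanD], which do not depend on [n], on natural numbers. *)
Definition cartan_nat (i j : nat) : int :=
  if i == j then 2
  else if (i, j) \in [:: (0, 2); (2, 0); (1, 2); (2, 1)]%N then -1
  else if [&& 3 <= j & j == i.+1 :> nat]%N || [&& 3 <= i & i == j.+1 :> nat]%N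
    then -1
  else 0.

Lemma cartanDE n (i j : 'I_n.+1) : cartanD n i j = cartan_nat i j.
Proof. by rewrite mxE. Qed.

Lemma cartan_fork (s t : bool) : cartan_nat s t = if s == t then 2 else 0.
Proof. by case: s t => [] []. Qed.

Lemma cartan_fork_chain (s : bool) k :
  cartan_nat s k.+2 = if k == 0%N then -1 else 0.
Proof. by case: s k => [] [|[|k]]. Qed.

Lemma cartan_chain_fork (s : bool) k :
  cartan_nat k.+2 s = if k == 0%N then -1 else 0.
Proof. by case: s k => [] [|[|k]]. Qed.

Lemma cartan_chain k l : cartan_nat k.+2 l.+2 =
  if k == l then 2 else if (l == k.+1) || (k == l.+1) then -1 else 0.
Proof.
by case: k l => [|k] [|l]; rewrite /cartan_nat !inE !xpair_eqE ?eqSS ?andbF.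
Qed.

(** * The relations for a system of fermions *)

Section Fermions.
Context (vT : vectType rat) (n : nat).
(* [P] is the parity, [p i] and [a i] create and annihilate the i-th fermion.
   For [n <= i] they only have to anticommute; this covers operators that
   vanish from index [n] on. *)
Context (P : 'End(vT)) (p a : nat -> 'End(vT)).
Context (parityK : (P \o P)%VF = \1%VF).
Context (p_odd : forall i, acomm P (p i) = 0).
Context (a_odd : forall i, acomm P (a i) = 0).
Context (acomm_pp : forall i j, acomm (p i) (p j) = 0).
Context (acomm_aa : forall i j, acomm (a i) (a j) = 0).
Context (acomm_pa : forall i j,
  acomm (p i) (a j) = ((i < n)%N && (i == j))%:R *: \1%VF).
Implicit Types (s t b : bool) (x y : 'End(vT)) (i j k l : nat).

(** The projection onto the even part ([s] false) or the odd part ([s] true). *)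
Definition proj s : 'End(vT) := 2^-1 *: (\1%VF + (-1) ^+ s *: P).

Lemma parity_proj s : (P \o proj s)%VF = (-1) ^+ s *: proj s.
Proof.
rewrite -comp_lfunZr comp_lfunDr comp_lfun1r -comp_lfunZr parityK.
rewrite scalerA mulrC -scalerA; congr (_ *: _).
by rewrite scalerDr scalerA -expr2 sqrr_sign scale1r addrC.
Qed.

Lemma proj_comp s t : (proj s \o proj t)%VF = (s == t)%:R *: proj t.
Proof.
rewrite -comp_lfunZl comp_lfunDl comp_lfun1l -comp_lfunZl parity_proj.
rewrite scalerA -{1}[proj t]scale1r -scalerDl scalerA; congr (_ *: _).
by case: s t => [] [].
Qed.

Lemma proj_compl s : proj (~~ s) + proj s = \1%VF.
Proof.
rewrite -scalerDr addrACA -scalerDl.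
have -> : (-1) ^+ (~~ s) + (-1) ^+ s = 0 :> rat by case: s.
by rewrite scale0r addr0 -mulr2n -scaler_nat scalerA mulVf // scale1r.
Qed.

Lemma odd_proj s x : acomm P x = 0 -> (proj s \o x = x \o proj (~~ s))%VF.
Proof.
move=> /acomm0_compE Px; rewrite -comp_lfunZl -comp_lfunZr comp_lfunDl
  comp_lfunDr.
rewrite comp_lfun1l comp_lfun1r -comp_lfunZl -comp_lfunZr Px scalerN -scaleNr.
by case: s; rewrite ?opprK.
Qed.

Lemma lcomm_half_same s x y : acomm P x = 0 -> acomm P y = 0 ->
  lcomm (x \o proj s)%VF (y \o proj s)%VF = 0.
Proof.
have z (u v : 'End(vT)) : acomm P v = 0 ->
    ((u \o proj s) \o (v \o proj s))%VF = 0.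
  move=> Pv; rewrite comp_lfunA -(comp_lfunA u) (odd_proj _ Pv) -!comp_lfunA
    proj_comp.
  by case: s; rewrite scale0r !comp_lfun0r.
by move=> Px Py; rewrite /lcomm !z // subrr.
Qed.

Lemma lcomm_half s (c : rat) x y : acomm P x = 0 -> acomm P y = 0 ->
    acomm x y = c *: \1%VF ->
  lcomm (x \o proj s)%VF (y \o proj (~~ s))%VF = (x \o y)%VF - c *: proj s.
Proof.
move=> Px Py xy; have Qx := odd_proj (~~ s) Px; rewrite negbK in Qx.
have Q1 t : (proj t \o proj t)%VF = proj t by rewrite proj_comp eqxx scale1r.
exact: lcomm_cutoff (odd_proj s Py) Qx (Q1 _) (Q1 _) (proj_compl s) xy.
Qed.

Lemma lcomm_proj_half s t x : acomm P x = 0 ->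
  lcomm (proj s) (x \o proj t)%VF = (-1) ^+ (s == t) *: (x \o proj t)%VF.
Proof.
move=> Px; rewrite /lcomm comp_lfunA (odd_proj _ Px) -!comp_lfunA !proj_comp.
case: (eqVneq s t) => [<-|st].
  have -> : (~~ s == s) = false by case: s {Px}.
  by rewrite scale0r comp_lfun0r scale1r sub0r expr1 scaleN1r.
have -> : ~~ s == t by case: s t st => [] [].
by rewrite scale0r comp_lfun0r !scale1r subr0.
Qed.

(** The operator moving a fermion from [j] to [i], the analogue of the matrix
    unit at (i, j). *)
Definition hop i j : 'End(vT) := (p i \o a j)%VF.

Lemma acomm_ap i j : acomm (a i) (p j) = ((i < n)%N && (i == j))%:R *: \1%VF.
Proof.
by rewrite acommC acomm_pa eq_sym; case: eqVneq => [->|_]; rewrite ?andbF.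
Qed.

Lemma lcomm_hop_p i j k : (i < n)%N -> (j < n)%N ->
  lcomm (hop i j) (p k) = (j == k)%:R *: p i.
Proof.
move=> ltin ltjn; rewrite lcomm_compl_acomm acomm_pp acomm_ap ltjn.
by rewrite comp_lfun0l subr0 -comp_lfunZr comp_lfun1r.
Qed.

Lemma lcomm_hop_a i j k : (i < n)%N -> (j < n)%N ->
  lcomm (hop i j) (a k) = - ((i == k)%:R *: a j).
Proof.
move=> ltin ltjn; rewrite lcomm_compl_acomm acomm_aa acomm_pa ltin.
by rewrite comp_lfun0r sub0r -comp_lfunZl comp_lfun1l.
Qed.

Lemma lcomm_hop i j k l : (i < n)%N -> (j < n)%N ->
  lcomm (hop i j) (hop k l) = (j == k)%:R *: hop i l - (i == l)%:R *: hop k j.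
Proof.
move=> ltin ltjn; rewrite lcomm_compr lcomm_hop_p // lcomm_hop_a //.
by rewrite comp_lfunNr -comp_lfunZl -comp_lfunZr.
Qed.

Lemma lcomm_hop_proj i j s : lcomm (hop i j) (proj s) = 0.
Proof.
rewrite lcommZr lcommDr lcommZr [lcomm _ \1%VF]/lcomm comp_lfun1l comp_lfun1r
  subrr.
rewrite lcomm_compl_acomm acommC a_odd acommC p_odd.
by rewrite comp_lfun0r comp_lfun0l subr0 scaler0 addr0 scaler0.
Qed.

Lemma lcomm_hop_p_proj i j k s : (i < n)%N -> (j < n)%N ->
  lcomm (hop i j) (p k \o proj s)%VF = (j == k)%:R *: (p i \o proj s)%VF.
Proof.
move=> ltin ltjn; rewrite lcomm_compr lcomm_hop_proj comp_lfun0r addr0.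
by rewrite lcomm_hop_p // comp_lfunZl.
Qed.

Lemma lcomm_hop_a_proj i j k s : (i < n)%N -> (j < n)%N ->
  lcomm (hop i j) (a k \o proj s)%VF = - ((i == k)%:R *: (a j \o proj s)%VF).
Proof.
move=> ltin ltjn; rewrite lcomm_compr lcomm_hop_proj comp_lfun0r addr0.
by rewrite lcomm_hop_a // comp_lfunNl comp_lfunZl.
Qed.

Lemma lcomm_proj_proj s t : lcomm (proj s) (proj t) = 0.
Proof.
rewrite /lcomm !proj_comp eq_sym; case: eqP => [->|_]; first exact: subrr.
by rewrite !scale0r subrr.
Qed.

(** When H = - P, the combinations that define T_i, S_i, E_0 and F_0 restrict an
    odd operator to one of the two parts. *)
Lemma half_odd s x : acomm P x = 0 ->
  2^-1 *: (x + (-1) ^+ s *: (2^-1 *: lcomm (- P) x)) = (x \o proj s)%VF.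
Proof.
move=> /acomm0_compE Px; rewrite lcommNl /lcomm Px opprB opprK -mulr2n
  -scaler_nat.
rewrite (scalerA 2^-1) mulVf // scale1r -comp_lfunZr comp_lfunDr comp_lfun1r.
by rewrite -comp_lfunZr.
Qed.

(** Composing an odd operator with [P] turns a left derivative into a right
    one; this lemma and the next two concern such twisted operators. This one
    gives H = - P. *)
Lemma lcomm_twisted x y : acomm P x = 0 -> acomm x y = \1%VF ->
  lcomm x (P \o y)%VF = - P.
Proof.
rewrite acommC => /acomm0_compE xP xy; rewrite /lcomm comp_lfunA xP comp_lfunNl.
by rewrite -!comp_lfunA -opprD -comp_lfunDr -/(acomm x y) xy comp_lfun1r.
Qed.

Lemma twisted_odd y : acomm P y = 0 -> acomm P (P \o y)%VF = 0.
Proof.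
move=> Py; rewrite /acomm -(comp_lfunA P y) -comp_lfunDr -/(acomm P y) Py.
exact: comp_lfun0r.
Qed.

Lemma twisted_proj s y : acomm P y = 0 ->
  ((P \o y) \o proj s)%VF = - ((-1) ^+ s *: (y \o proj s)%VF).
Proof.
move=> /acomm0_compE->; rewrite comp_lfunNl -comp_lfunA parity_proj.
by rewrite -comp_lfunZr.
Qed.

(** The Chevalley generators in terms of fermions. At the end s of the fork, E
    acts on the part of parity s and F on the opposite part. *)
Definition fermE i : 'End(vT) :=
  match i with
  | 0 => (a 0 \o proj false)%VF
  | 1 => (a 0 \o proj true)%VF
  | k.+2 => hop k k.+1
  end.

Definition fermF i : 'End(vT) :=
  match i with
  | 0 => (p 0 \o proj true)%VF
  | 1 => (p 0 \o proj false)%VF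
  | k.+2 => hop k.+1 k
  end.

Definition fermH i : 'End(vT) := lcomm (fermE i) (fermF i).

Lemma fermE_fork s : fermE s = (a 0 \o proj s)%VF.
Proof. by case: s. Qed.

Lemma fermF_fork s : fermF s = (p 0 \o proj (~~ s))%VF.
Proof. by case: s. Qed.

Lemma fermE_chain k : fermE k.+2 = hop k k.+1. Proof. by []. Qed.
Lemma fermF_chain k : fermF k.+2 = hop k.+1 k. Proof. by []. Qed.

Context (n_gt0 : (0 < n)%N).

Lemma fermH_fork s : fermH s = proj (~~ s) - hop 0 0.
Proof.
rewrite /fermH fermE_fork fermF_fork lcommC.
have := @lcomm_half (~~ s) 1 (p 0) (a 0); rewrite negbK => ->;
  rewrite ?p_odd ?a_odd //.
  by rewrite scale1r opprB.
by rewrite acomm_pa n_gt0 eqxx.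
Qed.

Lemma fermH_chain k : (k.+1 < n)%N -> fermH k.+2 = hop k k - hop k.+1 k.+1.
Proof.
by move=> ltkn; rewrite /fermH /= lcomm_hop ?eqxx ?scale1r // ltnW.
Qed.

Lemma lcomm_fermH i j : node_spec n i -> node_spec n j ->
  lcomm (fermH i) (fermH j) = 0.
Proof.
have lhh k l : (k < n)%N -> lcomm (hop k k) (hop l l) = 0.
  by move=> ltkn; rewrite lcomm_hop //; case: eqVneq => [->|_];
    rewrite ?scale0r subrr.
have lph s k : lcomm (proj s) (hop k k) = 0.
  by rewrite lcommC lcomm_hop_proj oppr0.
case=> [s|k ltkn] [t|l ltln]; rewrite ?fermH_fork ?fermH_chain // lcommBl
  !lcommDr !lcommNr;
  by rewrite ?lcomm_proj_proj ?lph ?lcomm_hop_proj ?lhh ?(ltnW ltkn) //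
    !(subr0, oppr0).
Qed.

Lemma lcomm_fermE_fermF i j : node_spec n i -> node_spec n j ->
  lcomm (fermE i) (fermF j) = (i == j)%:R *: fermH i.
Proof.
move=> [s|k ltkn] [t|l ltln].
- case: (eqVneq s t) => [<-|st]; first by rewrite eqxx scale1r.
  have -> : (s == t :> nat) = false by case: s t st => [] [].
  have -> : t = ~~ s by case: s t st => [] [].
  rewrite scale0r fermE_fork // fermF_fork // negbK.
  exact: lcomm_half_same (a_odd _) (p_odd _).
- rewrite fermE_fork // fermF_chain // lcommC
    (lcomm_hop_a_proj _ _ ltln (ltnW ltln)).
  by case: s; rewrite /= scale0r !oppr0 scale0r.
- rewrite fermE_chain // fermF_fork // (lcomm_hop_p_proj _ _ (ltnW ltkn) ltkn).
  by case: t; rewrite /= !scale0r.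
- rewrite eqSS eqSS; case: eqVneq => [<-|kl]; first by rewrite scale1r.
  rewrite fermE_chain // fermF_chain // (lcomm_hop _ _ (ltnW ltkn) ltkn) eqSS
    (negbTE kl).
  by rewrite !scale0r subrr.
Qed.

Lemma lcomm_fermH_fermE i j : node_spec n i -> node_spec n j ->
  lcomm (fermH i) (fermE j) = (cartan_nat j i)%:~R *: fermE j.
Proof.
move=> [s|k ltkn] [t|l ltln].
- rewrite cartan_fork fermH_fork // fermE_fork // lcommBl lcomm_hop_a_proj //.
  rewrite lcomm_proj_half ?a_odd // eqxx opprK -scalerDl.
  by case: s t => [] [].
- rewrite cartan_chain_fork fermH_fork // fermE_chain // lcommBl lcommC
    lcomm_hop_proj.
  rewrite lcomm_hop // oppr0 sub0r.
  by case: l ltln => [|l] ltln /=; rewrite !(scale1r, scale0r, subr0, oppr0)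
    ?scaleN1r.
- rewrite cartan_fork_chain fermH_chain // fermE_fork // lcommBl.
  rewrite !(lcomm_hop_a_proj _ _ ltkn ltkn,
            lcomm_hop_a_proj _ _ (ltnW ltkn) (ltnW ltkn)) opprK.
  by case: k ltkn => [|k] ltkn /=; rewrite !(scale1r, scale0r, addr0, oppr0)
    ?scaleN1r.
- rewrite cartan_chain fermH_chain // fermE_chain // lcommBl
    (lcomm_hop _ _ ltkn ltkn) eqSS.
  rewrite (lcomm_hop _ _ (ltnW ltkn) (ltnW ltkn)).
  rewrite [l == k]eq_sym.
  case: (eqVneq k l) => [<-|kl].
    by rewrite (ltn_eqF (ltnSn _)) (gtn_eqF (ltnSn _)) !scale0r scale1r subr0
      sub0r opprK -mulr2n -scaler_nat.
  rewrite !scale0r sub0r subr0 [l == _]eq_sym.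
  case: eqVneq => [kl1|_]; rewrite /= ?scale0r ?scale1r.
    by rewrite kl1 (gtn_eqF (leqW (ltnSn l))) scale0r oppr0 addr0 scaleN1r.
  rewrite oppr0 add0r.
  by case: eqVneq => [<-|_]; rewrite ?scale1r ?scale0r ?scaleN1r ?oppr0.
Qed.

Lemma lcomm_fermH_fermF i j : node_spec n i -> node_spec n j ->
  lcomm (fermH i) (fermF j) = - (cartan_nat j i)%:~R *: fermF j.
Proof.
move=> [s|k ltkn] [t|l ltln].
- rewrite cartan_fork fermH_fork // fermF_fork // lcommBl lcomm_hop_p_proj //.
  rewrite lcomm_proj_half ?p_odd // eqxx -scalerBl.
  by case: s t => [] [].
- rewrite cartan_chain_fork fermH_fork // fermF_chain // lcommBl lcommC
    lcomm_hop_proj.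
  rewrite lcomm_hop // oppr0 sub0r.
  by case: l ltln => [|l] ltln /=; rewrite
    !(scale1r, scale0r, subr0, sub0r, oppr0, opprK).
- rewrite cartan_fork_chain fermH_chain // fermF_fork // lcommBl.
  rewrite !(lcomm_hop_p_proj _ _ ltkn ltkn,
            lcomm_hop_p_proj _ _ (ltnW ltkn) (ltnW ltkn)).
  by case: k ltkn => [|k] ltkn /=; rewrite
    !(scale1r, scale0r, subr0, oppr0, opprK).
- rewrite cartan_chain fermH_chain // fermF_chain // lcommBl
    (lcomm_hop _ _ ltkn ltkn) eqSS.
  rewrite (lcomm_hop _ _ (ltnW ltkn) (ltnW ltkn)).
  rewrite [l == k]eq_sym.
  case: (eqVneq k l) => [<-|kl].
    rewrite (ltn_eqF (ltnSn _)) (gtn_eqF (ltnSn _)) !scale0r scale1r subr0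
      sub0r.
    by rewrite -opprD -mulr2n -scaler_nat scaleNr.
  rewrite !scale0r sub0r subr0 opprK [l == _]eq_sym.
  case: eqVneq => [kl1|_]; rewrite /= ?scale0r ?scale1r.
    by rewrite kl1 (gtn_eqF (leqW (ltnSn l))) scale0r addr0.
  rewrite add0r.
  by case: eqVneq => [<-|_]; rewrite ?oppr0 ?opprK ?scale1r ?scale0r.
Qed.

Lemma serre_fermE i j : node_spec n i -> node_spec n j -> i != j ->
  iter (absz (- cartan_nat j i + 1)) (ad (fermE i)) (fermE j) = 0.
Proof.
move=> [s|k ltkn] [t|l ltln] ij.
- have -> : t = ~~ s by case: s t ij => [] [].
  rewrite cartan_fork; have -> : (~~ s == s) = false by case: s ij.
  rewrite /= /ad !fermE_fork (@lcomm_half s 0) ?acomm_aa ?a_odd ?scale0r //.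
  by rewrite subr0 acomm0_compxx ?acomm_aa.
- rewrite cartan_chain_fork fermE_fork fermE_chain.
  have e : lcomm (a 0 \o proj s)%VF (hop l l.+1) =
    (l == 0)%:R *: (a l.+1 \o proj s)%VF.
    by rewrite lcommC (lcomm_hop_a_proj _ _ (ltnW ltln) ltln) opprK.
  case: eqP e => [_|_]; rewrite /= /ad => ->; last by rewrite scale0r.
  by rewrite scale1r; apply: lcomm_half_same.
- rewrite cartan_fork_chain fermE_fork fermE_chain.
  have := lcomm_hop_a_proj 0 t (ltnW ltkn) ltkn.
  case: eqP => [k0|_]; rewrite /= /ad => ->; last by rewrite scale0r oppr0.
  rewrite scale1r lcommNr (lcomm_hop_a_proj _ _ (ltnW ltkn) ltkn).
  by rewrite (ltn_eqF (ltnSn _)) scale0r !oppr0.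
- rewrite cartan_chain !fermE_chain; rewrite !eqSS in ij.
  rewrite [l == k]eq_sym (negbTE ij) [l == k.+1]eq_sym.
  have := lcomm_hop l l.+1 (ltnW ltkn) ltkn.
  case: (eqVneq k l.+1) => [kl|kl]; case: (eqVneq k.+1 l) => [kl1|kl1];
    rewrite /= /ad => ->.
  (* k = l + 1 and l = k + 1 are incompatible. *)
  + by move/eqP: kl1; rewrite kl (gtn_eqF (leqW (ltnSn l))).
  + rewrite scale0r sub0r scale1r lcommNr (lcomm_hop _ _ (ltnW ltkn) ltkn).
    by rewrite (negbTE kl1) (ltn_eqF (ltnSn _)) !scale0r subrr oppr0.
  + rewrite scale0r subr0 scale1r (lcomm_hop _ _ (ltnW ltkn) ltkn).
    by rewrite (negbTE kl) (gtn_eqF (ltnSn _)) !scale0r subrr.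
  + by rewrite !scale0r subrr.
Qed.

Lemma serre_fermF i j : node_spec n i -> node_spec n j -> i != j ->
  iter (absz (- cartan_nat j i + 1)) (ad (fermF i)) (fermF j) = 0.
Proof.
move=> [s|k ltkn] [t|l ltln] ij.
- have -> : t = ~~ s by case: s t ij => [] [].
  rewrite cartan_fork; have -> : (~~ s == s) = false by case: s ij.
  rewrite /= /ad !fermF_fork (@lcomm_half (~~ s) 0) ?acomm_pp ?p_odd ?scale0r
    //.
  by rewrite subr0 acomm0_compxx ?acomm_pp.
- rewrite cartan_chain_fork fermF_fork fermF_chain.
  have e : lcomm (p 0 \o proj (~~ s))%VF (hop l.+1 l) =
    - ((l == 0)%:R *: (p l.+1 \o proj (~~ s))%VF).
    by rewrite lcommC (lcomm_hop_p_proj _ _ ltln (ltnW ltln)).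
  case: eqP e => [_|_]; rewrite /= /ad => ->; last by rewrite scale0r oppr0.
  by rewrite scale1r lcommNr lcomm_half_same ?oppr0.
- rewrite cartan_fork_chain fermF_fork fermF_chain.
  have := lcomm_hop_p_proj 0 (~~ t) ltkn (ltnW ltkn).
  case: eqP => [k0|_]; rewrite /= /ad => ->; last by rewrite scale0r.
  rewrite scale1r (lcomm_hop_p_proj _ _ ltkn (ltnW ltkn)).
  by rewrite (ltn_eqF (ltnSn _)) scale0r.
- rewrite cartan_chain !fermF_chain; rewrite !eqSS in ij.
  rewrite [l == k]eq_sym (negbTE ij) [l == k.+1]eq_sym.
  have := lcomm_hop l.+1 l ltkn (ltnW ltkn).
  case: (eqVneq k l.+1) => [kl|kl]; case: (eqVneq k.+1 l) => [kl1|kl1];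
    rewrite /= /ad => ->.
  (* k = l + 1 and l = k + 1 are incompatible. *)
  + by move/eqP: kl1; rewrite kl (gtn_eqF (leqW (ltnSn l))).
  + rewrite scale0r subr0 scale1r (lcomm_hop _ _ ltkn (ltnW ltkn)).
    by rewrite (negbTE kl1) (ltn_eqF (ltnSn _)) !scale0r subrr.
  + rewrite scale0r sub0r scale1r lcommNr (lcomm_hop _ _ ltkn (ltnW ltkn)).
    by rewrite (negbTE kl) (gtn_eqF (ltnSn _)) !scale0r subrr oppr0.
  + by rewrite !scale0r subrr.
Qed.

(** Only the generators up to index [n] matter. *)
Lemma fermion_relations (E F : nat -> 'End(vT)) :
  (forall i, (i <= n)%N -> E i = fermE i) ->
  (forall i, (i <= n)%N -> F i = fermF i) ->
  forall i j : 'I_n.+1, let H k := lcomm (E k) (F k) in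
  [/\ lcomm (H i) (H j) = 0,
      lcomm (E i) (F j) = (i == j)%:R *: H i,
      lcomm (H i) (E j) = (cartanD n j i)%:~R *: E j /\
      lcomm (H i) (F j) = - (cartanD n j i)%:~R *: F j,
      i != j -> iter (absz (- cartanD n j i + 1)) (ad (E i)) (E j) = 0
    & i != j -> iter (absz (- cartanD n j i + 1)) (ad (F i)) (F j) = 0].
Proof.
move=> EE FF i j; have [lein lejn] : (i <= n)%N /\ (j <= n)%N.
  by rewrite -ltnS ltn_ord -ltnS ltn_ord.
rewrite /= !(EE i, EE j, FF i, FF j) // -!/(fermH _) cartanDE -(inj_eq val_inj).
have [ni nj] := (nodeP i, nodeP j).
split.
- exact: lcomm_fermH.
- exact: lcomm_fermE_fermF.
- by split; [exact: lcomm_fermH_fermE|exact: lcomm_fermH_fermF].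
- exact: serre_fermE.
- exact: serre_fermF.
Qed.

End Fermions.

(** * Creation and annihilation on monomials *)

Section Ladder.
Context (n : nat).
Implicit Types (K L : {set 'I_n}) (k l : 'I_n) (b : bool).

Lemma eq_lfun_mono (f g : 'End(ext n)) :
  (forall K, f (mono K) = g (mono K)) -> f = g.
Proof.
move=> fg; apply/lfunP => P; rewrite [P]ext_mono !linear_sum.
by apply: eq_bigr => K _; rewrite !linearZ /= fg.
Qed.

(** [k] is added to [K] if absent and removed if present. *)
Definition toggle k K := [set l | (l \in K) (+) (l == k)].

(** -1 to the number of elements of [K] below [k]. *)
Definition below k K : rat := \prod_(l in K) (-1) ^+ (l < k)%N.

(** -1 to the number of elements of [K] above [k]. *)
Definition above k K : rat := \prod_(l in K) (-1) ^+ (k < l)%N.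

(** -1 to the degree of [mono K]. *)
Definition grade K : rat := (-1) ^+ #|K|.

Lemma in_toggle k K l : (l \in toggle k K) = (l \in K) (+) (l == k).
Proof. by rewrite inE. Qed.

Lemma toggleC k l K : toggle k (toggle l K) = toggle l (toggle k K).
Proof. by apply/setP => m; rewrite !in_toggle addbAC. Qed.

Lemma toggleK k : involutive (toggle k).
Proof. by move=> K; apply/setP => m; rewrite !in_toggle addbK. Qed.

Lemma toggle_in k K : k \in K -> toggle k K = K :\ k.
Proof.
move=> kK; apply/setP => l; rewrite !inE.
by case: eqVneq => [->|_]; rewrite ?kK ?addbF.
Qed.

Lemma toggle_notin k K : k \notin K -> toggle k K = k |: K.
Proof.
move=> kK; apply/setP => l; rewrite !inE.
by case: eqVneq => [->|_]; rewrite ?(negbTE kK) ?addbF.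
Qed.

Lemma prod_toggle (f : 'I_n -> bool) k K :
  \prod_(l in toggle k K) (-1) ^+ f l =
  (-1) ^+ f k * \prod_(l in K) (-1) ^+ f l :> rat.
Proof.
case: (boolP (k \in K)) => kK.
  by rewrite (big_setD1 k kK) /= mulrA -expr2 sqrr_sign mul1r toggle_in.
by rewrite toggle_notin // big_setU1.
Qed.

Lemma below_toggle k l K : below k (toggle l K) = (-1) ^+ (l < k)%N * below k K.
Proof. exact: prod_toggle. Qed.

Lemma grade_toggle k K : grade (toggle k K) = - grade K.
Proof.
rewrite /grade -!prodr_const.
by have /= := prod_toggle (fun=> true) k K; rewrite expr1 mulN1r.
Qed.

Lemma below2 k K : below k K * below k K = 1.
Proof.
rewrite /below -big_split big1 //= => l _.
by rewrite -expr2 sqrr_sign.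
Qed.

Lemma aboveE k K : above k K = below k K * ((-1) ^+ (k \in K) * grade K).
Proof.
rewrite -[LHS]mul1r -[X in X * _ = _](below2 k K) -mulrA; congr (_ * _).
rewrite /below /above -big_split /grade -prodr_const /=.
case: (boolP (k \in K)) => kK.
  rewrite (big_setD1 k kK) [X in _ = _ * X](big_setD1 k kK) /= ltnn.
  rewrite !expr0 !expr1 !mul1r !mulN1r opprK; apply: eq_bigr => l;
    rewrite !inE => /andP[lk _].
  by case: ltngtP lk => // /val_inj->; rewrite eqxx.
rewrite mul1r; apply: eq_bigr => l lK.
by case: ltngtP (lK) => // /val_inj lk; rewrite -lk lK in kK.
Qed.

Lemma sign_card (f : pred 'I_n) K :
  (-1) ^+ #|[set l in K | f l]| = \prod_(l in K) (-1) ^+ f l :> rat.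
Proof.
rewrite -prodr_const (bigID f (mem K)) /= [X in _ = _ * X]big1 ?mulr1.
  rewrite (eq_bigl (fun l => (l \in K) && f l)) => [|l]; last by rewrite inE.
  by apply: eq_bigr => l /andP[_ ->].
by move=> l /andP[_ /negbTE->].
Qed.

Lemma alphap_mono k K :
  alphap n k (mono K) = if k \in K then 0 else below k K *: mono (toggle k K).
Proof.
rewrite lfunE /= /phi valK wedge_monoE /wedge_mono disjoints1.
case: (boolP (k \in K)) => //= kK; rewrite toggle_notin // /below -sign_card.
congr (_ ^+ _ *: _).
(* The inversions between k and K are the pairs (k, y) with y < k in K. *)
have pair_inj : injective (@pair 'I_n 'I_n k) by move=> x y [].
rewrite -(card_imset _ pair_inj).
congr #|pred_of_set _|; apply/setP => -[x y]; rewrite !inE /=.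
apply/andP/imsetP => [[/andP[/eqP-> yK] ky]|[z]].
  by exists y; rewrite ?inE ?yK.
by rewrite inE => /andP[zK zk] [-> ->]; rewrite eqxx.
Qed.

Lemma alpham_mono k K :
  alpham n k (mono K) = if k \in K then above k K *: mono (toggle k K) else 0.
Proof.
rewrite lfunE /= rderiv_monoE /rderiv_mono valK sign_card.
by case: ifP => // kK; rewrite toggle_in.
Qed.

(** The parity operator, equal to (-1)^d on the part of degree d. *)
Definition parity_fun (P : ext n) : ext n := [ffun K => grade K * P K].

Fact parity_is_linear : linear parity_fun.
Proof.
move=> c P Q; apply/ffunP => K; rewrite !ffunE mulrDr; congr (_ + _).
exact: mulrCA.
Qed.

HB.instance Definition _ :=
  GRing.isLinear.Build rat (ext n) (ext n) _ parity_fun parity_is_linear.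

Definition parity : 'End(ext n) := linfun parity_fun.

Lemma parity_mono K : parity (mono K) = grade K *: mono K.
Proof.
rewrite lfunE; apply/ffunP => L; rewrite !ffunE [RHS]/=.
by case: eqVneq => [->|_]; rewrite ?mulr0 ?scaler0.
Qed.

(** The annihilation operator. Composing the right derivative with the parity
    makes its sign on monomials the same as that of creation, see
    [ladder_mono]. *)
Definition annih i : 'End(ext n) := (parity \o alpham n i)%VF.

Lemma annih_mono k K :
  annih k (mono K) = if k \in K then below k K *: mono (toggle k K) else 0.
Proof.
rewrite comp_lfunE alpham_mono; case: ifP => kK; last exact: linear0.
rewrite linearZ /= parity_mono scalerA grade_toggle; congr (_ *: _).
by rewrite aboveE kK expr1 mulN1r !mulrN mulNr opprK -mulrA -expr2 sqrr_sign
  mulr1.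
Qed.

(** Creation ([b] false) and annihilation ([b] true) under one name. *)
Definition ladder b : nat -> 'End(ext n) := if b then annih else alphap n.

(** Both kinds toggle one index, with the same sign, and differ only in the
    monomials that they kill. *)
Lemma ladder_mono b k K :
  ladder b k (mono K) =
  if (k \in K) == b then below k K *: mono (toggle k K) else 0.
Proof.
by case: b; rewrite ?annih_mono ?alphap_mono; case: (k \in K).
Qed.

Lemma ladder_ge b i : (n <= i)%N -> ladder b i = 0.
Proof.
move=> ni.
have z_alpham : alpham n i = 0.
  by apply: eq_lfun_mono => K; rewrite lfunE zero_lfunE /= rderiv_monoE
    /rderiv_mono insubF // ltnNge ni.
case: b; first by rewrite /= /annih z_alpham comp_lfun0r.
apply: eq_lfun_mono => K; rewrite lfunE zero_lfunE /= /phi insubF 1?ltnNge ?ni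
  //.
by rewrite /wedge big1 // => L _; rewrite big1 // => M _;
  rewrite ffunE mul0r scale0r.
Qed.

(** Exchanging the two operators only changes the sign (-1)^[l < k], whence the
    anticommutation. *)
Lemma ladder_ladder_mono b c k l K : k != l ->
  ladder b k (ladder c l (mono K)) =
  if ((k \in K) == b) && ((l \in K) == c) then
    (-1) ^+ (l < k)%N *:
      ((below k K * below l K) *: mono (toggle k (toggle l K)))
  else 0.
Proof.
move=> /negbTE kl; rewrite ladder_mono andbC.
case: eqP => lc /=; last exact: linear0.
rewrite linearZ /= ladder_mono in_toggle kl addbF.
case: eqP => kb; last exact: scaler0.
by rewrite !scalerA below_toggle mulrC mulrA.
Qed.

Lemma ladder_acomm_neq b c k l : k != l -> acomm (ladder b k) (ladder c l) = 0.
Proof.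
move=> kl; apply: eq_lfun_mono => K; rewrite add_lfunE !comp_lfunE zero_lfunE.
have lk : l != k by rewrite eq_sym.
rewrite (ladder_ladder_mono _ _ _ kl) (ladder_ladder_mono _ _ _ lk) andbC;
  case: ifP => _; last exact: addr0.
rewrite (toggleC l) [below l K * _]mulrC -scalerDl.
by case: ltngtP kl => [||/val_inj->]; rewrite ?eqxx //= (subrr, addNr) scale0r.
Qed.

Lemma ladder_acomm_same b k : acomm (ladder b k) (ladder b k) = 0.
Proof.
apply: eq_lfun_mono => K.
rewrite add_lfunE !comp_lfunE !ladder_mono zero_lfunE.
case: eqP => kb; rewrite ?linear0 ?addr0 // linearZ /= ladder_mono in_toggle
  eqxx.
by rewrite kb addbT; case: (b); rewrite ?scaler0 ?addr0.
Qed.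

Lemma ladder_acomm_dual b k : acomm (ladder b k) (ladder (~~ b) k) = \1%VF.
Proof.
apply: eq_lfun_mono => K; rewrite add_lfunE !comp_lfunE !ladder_mono id_lfunE.
have -> : ((k \in K) == ~~ b) = ~~ ((k \in K) == b)
  by case: (k \in K) (b) => [] [].
case: (boolP (_ == b)) => kb /=; rewrite linear0 ?add0r ?addr0 linearZ /=.
all: rewrite ladder_mono in_toggle eqxx addbT.
all: rewrite (_ : (~~ (k \in K) == _) = true) ?toggleK ?below_toggle ?ltnn
  ?mul1r.
all: by rewrite ?scalerA ?below2 ?scale1r //; case: (k \in K) (b) kb => [] [].
Qed.

Lemma parityK : (parity \o parity)%VF = \1%VF.
Proof.
apply: eq_lfun_mono => K; rewrite comp_lfunE parity_mono linearZ /= parity_mono.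
by rewrite scalerA -expr2 sqrr_sign scale1r id_lfunE.
Qed.

Lemma parity_ladder b i : acomm parity (ladder b i) = 0.
Proof.
have [ni|ltin] := leqP n i.
  by rewrite ladder_ge // /acomm comp_lfun0l comp_lfun0r addr0.
rewrite -[i]/(nat_of_ord (Ordinal ltin)); move: (Ordinal _) => {ltin}k {i}.
apply: eq_lfun_mono => K.
rewrite add_lfunE !comp_lfunE parity_mono linearZ /= ladder_mono zero_lfunE.
case: ifP => _; last by rewrite linear0 scaler0 addr0.
by rewrite linearZ /= parity_mono grade_toggle scaleNr scalerN scalerA mulrC
  -scalerA addNr.
Qed.

(** The canonical anticommutation relations. *)
Lemma ladder_acomm b c i j : (i < n)%N ->
  acomm (ladder b i) (ladder c j) = ((b != c) && (i == j))%:R *: \1%VF.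
Proof.
move=> ltin; case: (leqP n j) => [nj|ltjn].
  rewrite (ladder_ge c nj) /acomm comp_lfun0l comp_lfun0r addr0.
  by rewrite (ltn_eqF (leq_trans ltin nj)) andbF scale0r.
rewrite -[i]/(nat_of_ord (Ordinal ltin)) -[j]/(nat_of_ord (Ordinal ltjn)).
move: (Ordinal ltin) (Ordinal ltjn) => k l {i j ltin ltjn}.
rewrite (inj_eq val_inj); case: (eqVneq k l) => [<-|kl]; last first.
  by rewrite andbF scale0r ladder_acomm_neq.
rewrite andbT; case: (eqVneq b c) => [<-|bc].
  by rewrite scale0r ladder_acomm_same.
by rewrite scale1r -(ladder_acomm_dual b k); case: (b) (c) bc => [] [].
Qed.

End Ladder.

(** * The generators as fermionic operators *)

Section Generators.
Context (n : nat).
Context (n_gt0 : (0 < n)%N).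

Local Notation P := (parity n).
Local Notation p := (alphap n).
Local Notation a := (annih n).

Lemma parity_alphap i : acomm P (p i) = 0.
Proof. exact: (parity_ladder n false). Qed.

Lemma parity_annih i : acomm P (a i) = 0.
Proof. exact: (parity_ladder n true). Qed.

Lemma ladder_acomm_eq b i j : acomm (ladder n b i) (ladder n b j) = 0.
Proof.
have [ni|ltin] := leqP n i.
  by rewrite (ladder_ge b ni) /acomm comp_lfun0l comp_lfun0r addr0.
by rewrite ladder_acomm // eqxx scale0r.
Qed.

Lemma acomm_alphap i j : acomm (p i) (p j) = 0.
Proof. exact: (ladder_acomm_eq false). Qed.

Lemma acomm_annih i j : acomm (a i) (a j) = 0.
Proof. exact: (ladder_acomm_eq true). Qed.

Lemma acomm_alphap_annih i j :
  acomm (p i) (a j) = ((i < n)%N && (i == j))%:R *: \1%VF.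
Proof.
case: ltnP => [ltin|ni]; first exact: (ladder_acomm false true j ltin).
rewrite scale0r -[p i]/(ladder n false i) (ladder_ge false ni).
by rewrite /acomm comp_lfun0l comp_lfun0r addr0.
Qed.

Lemma alphamE i : alpham n i = (P \o a i)%VF.
Proof. by rewrite comp_lfunA parityK comp_lfun1l. Qed.

Lemma opHE : opH n = - P.
Proof.
rewrite /opH alphamE; apply: lcomm_twisted (parity_alphap 0) _.
by rewrite acomm_alphap_annih n_gt0 scale1r.
Qed.

Lemma opTE i : opT n i = (p i \o proj P false)%VF.
Proof.
rewrite /opT opHE -(half_odd _ (parity_alphap i)).
by rewrite expr0 scale1r.
Qed.

Lemma opSE i : opS n i = (a i \o proj P true)%VF.
Proof.
rewrite /opS opHE alphamE -scaleN1r -[-1]expr1.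
rewrite (half_odd true (twisted_odd (parity_annih i))).
by rewrite (twisted_proj (parityK n) _ (parity_annih i)) expr1 scaleN1r opprK.
Qed.

Lemma genEE i : (i <= n)%N -> genE n i = fermE P p a i.
Proof.
case: i => [|[|k]] ltkn; rewrite /genE /fermE; last 1 first.
- rewrite opTE opSE.
  rewrite (@lcomm_half _ _ (parityK n) false 0 _ _
    (parity_alphap _) (parity_annih _)).
    by rewrite scale0r subr0.
  by rewrite acomm_alphap_annih ltn_eqF // andbF.
- rewrite opHE alphamE -[X in _ + X]scale1r
    -[X in X *: (2^-1 *: _)](expr0 (-1)).
  rewrite (half_odd false (twisted_odd (parity_annih 0))).
  by rewrite (twisted_proj (parityK n) _ (parity_annih 0)) expr0 scale1r opprK.
- exact: opSE.
Qed.

Lemma genFE i : (i <= n)%N -> genF n i = fermF P p a i.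
Proof.
case: i => [|[|k]] ltkn; rewrite /genF /fermF; last 1 first.
- rewrite opTE opSE.
  rewrite (@lcomm_half _ _ (parityK n) false 0 _ _
    (parity_alphap _) (parity_annih _)).
    by rewrite scale0r subr0.
  by rewrite acomm_alphap_annih gtn_eqF // andbF.
- rewrite opHE -scaleN1r -[X in X *: (2^-1 *: _)]expr1.
  exact: (half_odd true (parity_alphap 0)).
- exact: opTE.
Qed.

End Generators.

Unset Implicit Arguments.

Theorem theorem4p2 (n : nat) (n_ge1 : (1 <= n)%N) (i j : 'I_n.+1) :
  [/\ lcomm (genH n i) (genH n j) = 0,
      lcomm (genE n i) (genF n j) = (i == j)%:R *: genH n i,
      lcomm (genH n i) (genE n j) = (cartanD n j i)%:~R *: genE n j /\
      lcomm (genH n i) (genF n j) = - (cartanD n j i)%:~R *: genF n j,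
      i != j -> iter (absz (- cartanD n j i + 1)) (ad (genE n i)) (genE n j) = 0
    & i != j -> iter (absz (- cartanD n j i + 1)) (ad (genF n i)) (genF n j) = 0].
Proof.
exact: (fermion_relations (parityK n) (parity_alphap n) (parity_annih n)
  (@acomm_alphap n) (@acomm_annih n) (@acomm_alphap_annih n) n_ge1
  (genEE n_ge1) (genFE n_ge1) i j).
Qed.
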